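(* The $(a,b)$-algorithm takes time $O(Rw^2)$ to compactly display the order ideals of a $w$-element poset as a disjoint union of $R$ many $\{0,1,2,a,b\}$-valued rows. (Here $R$ is the number of final rows which the algorithm produces.)
   Context: An order ideal of a poset $(W,\le)$ is a subset $X\subseteq W$ such that $p\in X$ and $q\le p$ imply $q\in X$. $[w]=\{1,\dots,w\}$. A set $X$ satisfies an implication $A\to B$ if $A\subseteq X$ implies $B\subseteq X$. Rows. A $\{0,1,2,a,b\}$-valued row $r$ of length $w$ is a partition of $[w]$ into four (possibly empty) parts $\mathrm{zeros}(r)$, $\mathrm{ones}(r)$, $\mathrm{twos}(r)$, $\mathrm{implications}(r)$, where $\mathrm{implications}(r)$, if nonempty, is further partitioned as $\mathrm{prem}[1]\cup\mathrm{conc}[1]\cup\dots\cup\mathrm{prem}[t]\cup\mathrm{conc}[t]$ ($t\ge1$) with all $\mathrm{prem}[i]$ singletons and all $\mathrm{conc}[i]$ nonempty. The row $r$ represents the family of all $X\subseteq[w]$ with $\mathrm{ones}(r)\subseteq X$, $\mathrm{zeros}(r)\cap X=\emptyset$, and, for all $1\le i\le t$, $\mathrm{prem}[i]\subseteq X\Rightarrow \mathrm{conc}[i]\subseteq X$. Visually, $r$ is a string of length $w$ with symbols $0,1,2$ at the positions in $\mathrm{zeros}(r),\mathrm{ones}(r),\mathrm{twos}(r)$, symbol $a_i$ at the position in $\mathrm{prem}[i]$, and symbol $b_i$ at each position in $\mathrm{conc}[i]$. The $(a,b)$-algorithm. Let $(W,\le)$ be a $w$-element poset, relabelled so that $W=[w]$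 and $1,2,\dots,w$ is a linear extension of $\le$. For $j\in W$ let $LC(j)$ be the set of lower covers of $j$. The order ideals are exactly the sets satisfying all implications $\{j\}\to LC(j)$, $j=1,\dots,w$ (for minimal $j$ the conclusion is empty). The algorithm keeps a working stack of rows, initially containing only $(2,2,\dots,2)$, and each row records which implication is pending (initially $j=1$). Repeatedly, the topmost row $r$ of the stack is taken (last in, first out) and its pending implication $\{j\}\to B$, $B=LC(j)$, is imposed on it; the resulting one or two rows replace $r$ on top of the stack with pending implication $j+1$. A row upon which all $w$ implications have been imposed is moved to the final stack; the algorithm ends when the working stack is empty. Because of the linear extension ordering, the $j$-th entry of $r$ is always $2$ when $\{j\}\to B$ is imposed. The imposition of $\{j\}\to B$ on $r$ is as follows. Case 1: $B\cap\mathrm{zeros}(r)\ne\emptyset$. The $2$ at position $j$ becomes $0$. Case 2: $B\subseteq\mathrm{ones}(r)$. Then $r$ carries over unaltered. Case 3: at least one position in $B$ carries $2$ and the others, if any, carry $1$. The $2$ at position $j$ becomes a symbol $a$ and the $2$'s at positions in $B$ become symbols $b$, with a new common index (that is, a new pair $\mathrm{prem},\mathrm{conc}$ is created). Case 4: no position in $B$ carries $0$, but some position in $B$ carries a symbol $a_i$ or $b_i$. Then $r$ is replaced by two rows $r'$ and $r''$. Row $r'$ arises from $r$ by changing the $2$ at position $j$ to $0$. Row $r''$ arises from $r$ by changing position $j$ and all positions in $B$ to $1$, and updating: whenever the position of $a_i$ became $1$, all positions of $b_i$ become $1$; whenever some positions of $b_i$ became $1$ while $a_i$ did not, those positions are removed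 from $\mathrm{conc}[i]$, and if $\mathrm{conc}[i]$ thereby becomes empty, $a_i$ becomes $2$. The rows on the final stack are the final rows. *)

(* Defs.v *)
From mathcomp Require Import all_boot all_order.

Set Implicit Arguments.
Unset Strict Implicit.
Unset Printing Implicit Defensive.

(** Positions are numbered from 0: [w] is 'I_w = {0, ..., w-1}. *)

Section Poset.
Variables (d : Order.disp_t) (T : finPOrderType d).

Definition order_ideal (X : {set T}) : bool :=
  [forall p in X, forall q, (q <= p)%O ==> (q \in X)].

Variables (w : nat) (lab : 'I_w -> T).

(** [lab] lists the elements of the poset T as 0, 1, ..., w-1. *)
Definition linear_extension : Prop :=
  bijective lab /\ forall i j : 'I_w, (lab i <= lab j)%O -> i <= j.

Definition LC (j : 'I_w) : {set 'I_w} :=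
  [set i | (lab i < lab j)%O &&
           [forall x : T, ~~ ((lab i < x)%O && (x < lab j)%O)]].

End Poset.

(** * {0,1,2,a,b}-valued rows *)

Definition implication (w : nat) : Type := 'I_w * {set 'I_w}.

(** The singleton prem[i] is given by its element. *)
Definition prem w (c : implication w) : 'I_w := c.1.
Definition conc w (c : implication w) : {set 'I_w} := c.2.

Record row (w : nat) := Row {
  zeros : {set 'I_w};
  ones : {set 'I_w};
  twos : {set 'I_w};
  imps : seq (implication w)
}.

Definition row_blocks w (r : row w) : seq {set 'I_w} :=
  [:: zeros r, ones r, twos r & flatten [seq [:: [set prem c]; conc c] | c <- imps r]].

Definition is_row w (r : row w) : bool :=
  [&& pairwise (fun A B : {set 'I_w} => [disjoint A & B]) (row_blocks r),
      \bigcup_(A <- row_blocks r) A == setT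
    & all (fun c => conc c != set0) (imps r)].

Definition row_family w (r : row w) : {set {set 'I_w}} :=
  [set X : {set 'I_w} |
    [&& ones r \subset X, [disjoint zeros r & X]
      & all (fun c => ([set prem c] \subset X) ==> (conc c \subset X)) (imps r)]].

(** * The (a,b)-algorithm *)

Section Impose.
Variables (w : nat) (j : 'I_w) (B : {set 'I_w}) (r : row w).

Definition put_zero : row w :=
  Row (j |: zeros r) (ones r) (twos r :\ j) (imps r).

Definition put_ab : row w :=
  Row (zeros r) (ones r) (twos r :\: (j |: B))
      (rcons (imps r) (j, B :&: twos r)).

(** The row r'' of the last case.  A pair (p, C) with p in B loses its a and
    its b's to 1; if p is not in B, C shrinks to C :\: B, and when nothing is
    left the pair disappears and p becomes 2. *)
Definition put_ones : row w :=
  Row (zeros r)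
      (ones r :|: (j |: B) :|: \bigcup_(c <- imps r | prem c \in B) conc c)
      ((twos r :\: (j |: B)) :|:
         \bigcup_(c <- imps r | (prem c \notin B) && (conc c \subset B)) [set prem c])
      [seq (prem c, conc c :\: B) : implication w
         | c <- imps r & (prem c \notin B) && ~~ (conc c \subset B)].

Definition impose : seq (row w) :=
  if ~~ [disjoint B & zeros r] then [:: put_zero]
  else if B \subset ones r then [:: r]
  else if B \subset ones r :|: twos r then [:: put_ab]
  else [:: put_zero; put_ones].

End Impose.

(** (working stack, topmost row first and each row with its pending
    implication; final rows in the order in which they were found) *)
Definition config w : Type := seq (nat * row w) * seq (row w).

Definition init_config w : config w :=
  ([:: (0, Row set0 set0 setT [::])], [::]).

Definition ab_step w (lc : 'I_w -> {set 'I_w}) (s : config w) : config w :=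
  match s with
  | ([::], F) => ([::], F)
  | ((j, r) :: rest, F) =>
      if insub j is Some i
      then ([seq (j.+1, r') | r' <- impose i (lc i) r] ++ rest, F)
      else (rest, rcons F r)
  end.

Definition ab_final_rows w (lc : 'I_w -> {set 'I_w}) (F : seq (row w)) : Prop :=
  exists n, iter n (ab_step lc) (init_config w) = ([::], F).

(** * A uniform-cost random access machine *)

(** Programs have finitely many registers and finitely many two-dimensional
    arrays, all holding natural numbers.  Evaluating a constant or a register,
    an addition or a comparison, accessing one array cell, an assignment and a
    test all cost one unit; cells can only be accessed one at a time. *)

Inductive reg := rW | rSp | rNf | rD | rJ | rI | rV | rZero | rTwo | rAB.
Inductive arr := LCm | Stk | Pend | Fin | Live.

Scheme Boolean Equality for reg.
Scheme Boolean Equality for arr.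

Inductive expr :=
| Num of nat
| Reg of reg
| Cell of arr & expr & expr
| Add of expr & expr
| Sub of expr & expr
| Eqn of expr & expr
| Ltn of expr & expr.

Inductive cmd :=
| Skip
| Assign of reg & expr
| Store of arr & expr & expr & expr
| Seq of cmd & cmd
| If of expr & cmd & cmd
| While of expr & cmd.

Record state := State {
  regs : reg -> nat;
  cells : arr -> nat -> nat -> nat
}.

Definition set_reg (s : state) (x : reg) (v : nat) : state :=
  State (fun y => if reg_beq y x then v else regs s y) (cells s).

Definition set_cell (s : state) (a : arr) (m n v : nat) : state :=
  State (regs s)
    (fun b k l => if [&& arr_beq b a, k == m & l == n] then v
                  else cells s b k l).

Fixpoint eval (s : state) (e : expr) : nat :=
  match e with
  | Num n => n
  | Reg x => regs s x
  | Cell a e1 e2 => cells s a (eval s e1) (eval s e2)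
  | Add e1 e2 => eval s e1 + eval s e2
  | Sub e1 e2 => eval s e1 - eval s e2
  | Eqn e1 e2 => eval s e1 == eval s e2
  | Ltn e1 e2 => eval s e1 < eval s e2
  end.

Fixpoint cost (e : expr) : nat :=
  match e with
  | Num _ | Reg _ => 1
  | Cell _ e1 e2 | Add e1 e2 | Sub e1 e2 | Eqn e1 e2 | Ltn e1 e2 =>
      (cost e1 + cost e2).+1
  end.

(** [exec s c t s']: started in s, the program c halts in s' after t units. *)
Inductive exec : state -> cmd -> nat -> state -> Prop :=
| ExecSkip s : exec s Skip 1 s
| ExecAssign s x e :
    exec s (Assign x e) (cost e).+1 (set_reg s x (eval s e))
| ExecStore s a e1 e2 e :
    exec s (Store a e1 e2 e) (cost e1 + cost e2 + cost e).+1
         (set_cell s a (eval s e1) (eval s e2) (eval s e))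
| ExecSeq s1 s2 s3 c1 c2 t1 t2 :
    exec s1 c1 t1 s2 -> exec s2 c2 t2 s3 ->
    exec s1 (Seq c1 c2) (t1 + t2) s3
| ExecIfTrue s s' e c1 c2 t :
    eval s e != 0 -> exec s c1 t s' ->
    exec s (If e c1 c2) (cost e + t).+1 s'
| ExecIfFalse s s' e c1 c2 t :
    eval s e = 0 -> exec s c2 t s' ->
    exec s (If e c1 c2) (cost e + t).+1 s'
| ExecWhileTrue s1 s2 s3 e c t1 t2 :
    eval s1 e != 0 -> exec s1 c t1 s2 -> exec s2 (While e c) t2 s3 ->
    exec s1 (While e c) (cost e + t1 + t2).+1 s3
| ExecWhileFalse s e c :
    eval s e = 0 -> exec s (While e c) (cost e).+1 s.

(** * The (a,b)-algorithm as a machine program *)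

(** The input is the register rW, holding w, and LCm[j][i] = (i in LC(j)).
    The working stack occupies Stk[0], ..., Stk[rSp-1] (top last), the pending
    implication of the row Stk[k] being Pend[k][0]; the final rows are Fin[0],
    ..., Fin[rNf-1].  The entry at a position of a row is coded by
    0, 1, 2 for the symbols 0, 1, 2;  3 for any a_i;  4 + p for b_i, where p is
    the position carrying a_i. *)

Declare Scope prog_scope.
Delimit Scope prog_scope with prog.
Bind Scope prog_scope with expr.
Bind Scope prog_scope with cmd.

Coercion Num : nat >-> expr.
Coercion Reg : reg >-> expr.

Notation "a ![ m , n ]" := (Cell a m n)
  (at level 2, m at level 99, n at level 99, left associativity,
   format "a ![ m ,  n ]") : prog_scope.
Notation "x <~ e" := (Assign x e) (at level 75) : prog_scope.
Notation "c1 ;; c2" := (Seq c1 c2) (at level 85, right associativity) : prog_scope.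

Section Program.
Local Open Scope prog_scope.

Definition for_all_positions (c : cmd) : cmd :=
  rI <~ 0 ;; While (Ltn rI rW) (c ;; rI <~ Add rI 1).

Definition when (e : expr) (c : cmd) : cmd := If e c Skip.

Definition in_B : expr := LCm![rJ, rI].

Definition prog_init : cmd :=
  for_all_positions (Store Stk 0 rI 2) ;;
  Store Pend 0 0 0 ;; rSp <~ 1 ;; rNf <~ 0.

Definition prog_finish : cmd :=
  for_all_positions (Store Fin rNf rI Stk![rD, rI]) ;;
  rNf <~ Add rNf 1 ;; rSp <~ rD.

Definition prog_scan : cmd :=
  rZero <~ 0 ;; rTwo <~ 0 ;; rAB <~ 0 ;;
  for_all_positions
    (when in_B
       (rV <~ Stk![rD, rI] ;;
        If (Eqn rV 0) (rZero <~ 1)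
       (If (Eqn rV 2) (rTwo <~ 1)
                    (when (Ltn 2 rV) (rAB <~ 1))))).

Definition prog_put_zero : cmd := Store Stk rD rJ 0.

Definition prog_put_ab : cmd :=
  for_all_positions
    (when in_B (when (Eqn Stk![rD, rI] 2) (Store Stk rD rI (Add 4 rJ)))) ;;
  Store Stk rD rJ 3.

(** The third loop records in Live[p][0] whether some b belonging to the a at
    position p is left. *)
Definition prog_put_ones : cmd :=
  for_all_positions
    (rV <~ Stk![rD, rI] ;;
     when (Ltn 3 rV) (when LCm![rJ, Sub rV 4] (Store Stk rD rI 1))) ;;
  for_all_positions (when in_B (Store Stk rD rI 1) ;; Store Live rI 0 0) ;;
  Store Stk rD rJ 1 ;;
  for_all_positions
    (rV <~ Stk![rD, rI] ;; when (Ltn 3 rV) (Store Live (Sub rV 4) 0 1)) ;;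
  for_all_positions
    (when (Eqn Stk![rD, rI] 3) (when (Eqn Live![rI, 0] 0) (Store Stk rD rI 2))).

(** r'' takes the place of r in Stk[rD], and r' is pushed on top of it. *)
Definition prog_split : cmd :=
  for_all_positions (Store Stk rSp rI Stk![rD, rI]) ;;
  Store Stk rSp rJ 0 ;; Store Pend rSp 0 (Add rJ 1) ;; rSp <~ Add rSp 1 ;;
  prog_put_ones.

Definition prog_impose : cmd :=
  prog_scan ;;
  If rZero prog_put_zero
 (If rAB prog_split
 (If rTwo prog_put_ab
         Skip)) ;;
  Store Pend rD 0 (Add rJ 1).

Definition ab_program : cmd :=
  prog_init ;;
  While (Ltn 0 rSp)
    (rD <~ Sub rSp 1 ;; rJ <~ Pend![rD, 0] ;;
     If (Eqn rJ rW) prog_finish prog_impose).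

End Program.

(** Registers and cells not mentioned here may hold anything. *)
Definition input_state w (lc : 'I_w -> {set 'I_w}) (s : state) : Prop :=
  regs s rW = w /\ forall i j : 'I_w, cells s LCm j i = (i \in lc j).

Definition row_code w (r : row w) (p : 'I_w) : nat :=
  if p \in zeros r then 0
  else if p \in ones r then 1
  else if p \in twos r then 2
  else if [seq prem c | c <- imps r & p \in conc c] is q :: _ then 4 + q
  else 3.

Definition output_state w (F : seq (row w)) (s : state) : Prop :=
  regs s rNf = size F /\
  forall (k : nat) (r0 : row w) (p : 'I_w), k < size F ->
    cells s Fin k p = row_code (nth r0 F k) p.

(* Main.v *)
Require Import Defs.
From mathcomp Require Import all_boot all_order zify.

Set Implicit Arguments.
Unset Strict Implicit.
Unset Printing Implicit Defensive.

(** Imposing the implication of j splits the family of a row exactly into the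
    families of the resulting rows, restricted to the sets that satisfy this
    implication, and never yields zero rows.  Hence the rows in which the run
    ends partition the sets satisfying all implications, that is, the order
    ideals, and every row met on the way has a final row below it; at most R
    rows are therefore treated for each pending implication, which makes at most
    R (w + 1) steps.  A step of the machine consists of boundedly many sweeps
    over the positions, so it costs O(w).

    A row is well formed iff each position occurs exactly once in its parts;
    this determines the code of a position and is preserved because, when j is
    treated, the positions from j on still carry 2. *)

(** * Well-formed rows and the imposition of an implication *)

Lemma in_bigcup_seq (I : Type) (T : finType) (s : seq I) (P : pred I)
    (f : I -> {set T}) (x : T) :
  (x \in \bigcup_(i <- s | P i) f i) = has (fun i => P i && (x \in f i)) s.
Proof.
elim: s => [|i s IHs]; first by rewrite big_nil inE.
by rewrite big_cons /=; case: (P i) => //=; rewrite inE IHs.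
Qed.

(** A point of the first set must avoid all later ones, so its count over them is zero. This
    pointwise form serves both the parts of a row and the families of the final rows. *)
Lemma pairwise_disjointE (T : finType) (s : seq {set T}) :
  pairwise (fun A B : {set T} => [disjoint A & B]) s =
  [forall x, count (fun A : {set T} => x \in A) s <= 1].
Proof.
elim: s => [|A s IHs] /=; first by apply/esym/forallP.
rewrite IHs; apply/andP/forallP => [[/allP dAs /forallP le1] x|le1].
  case: (boolP (x \in A)) => [xA|_]; last exact: le1.
  rewrite add1n ltnS leqn0 -leqn0 leqNgt -has_count.
  apply/hasPn => B /dAs; rewrite disjoint_sym => /disjointFl -> //.
split; last by apply/forallP => x; apply: leq_trans (le1 x); apply: leq_addl.
apply/allP => B Bs; rewrite disjoint_subset; apply/subsetP => x xA; rewrite inE.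
apply/negP => xB; have := le1 x; rewrite xA add1n ltnS leqn0.
by rewrite -leqn0 leqNgt -has_count => /hasPn/(_ B Bs); rewrite xB.
Qed.

Section Rows.
Variable w : nat.
Implicit Types (r : row w) (p : 'I_w) (c : implication w).

(** A position that is both premise and element of the conclusion counts twice, so a total of 1 also
    separates [prem] from [conc]. *)
Definition occurrences p c : nat := (p == prem c) + (p \in conc c).

Definition multiplicity r p : nat :=
  (p \in zeros r) + (p \in ones r) + (p \in twos r) +
  sumn [seq occurrences p c | c <- imps r].

(** Pairwise disjointness of the parts bounds every multiplicity by 1, and covering makes it
    positive. *)
Lemma is_rowP r :
  reflect ((forall p, multiplicity r p = 1) /\
           {in imps r, forall c, conc c != set0})
          (is_row r).
Proof.
have mE p : count (fun A : {set 'I_w} => p \in A) (row_blocks r) =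
            multiplicity r p.
  rewrite /multiplicity /row_blocks /= !addnA; congr (_ + _).
  elim: (imps r) => [|c s IHs] //=; rewrite IHs /occurrences in_set1.
  by rewrite !addnA.
have cE p : (p \in \bigcup_(A <- row_blocks r) A) = (0 < multiplicity r p).
  by rewrite -mE in_bigcup_seq has_count.
rewrite /is_row pairwise_disjointE.
apply: (iffP and3P) => [[/forallP le1 /eqP cov /allP ne]|[m1 ne]].
  split=> // p; apply/eqP; rewrite eqn_leq -{1}mE le1 -cE cov.
  by rewrite inE.
split; last exact/allP.
  by apply/forallP => p; rewrite mE m1.
by apply/eqP/setP => p; rewrite cE m1 inE.
Qed.

Definition avoids p (s : seq (implication w)) : Prop :=
  {in s, forall c, p != prem c /\ p \notin conc c}.

(** Indexing by the three memberships and the code lets one case analysis rewrite all of them at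
    once. In the last two cases the unique pair containing [p] is exhibited by splitting the list
    around it. *)
Variant row_position r p : bool -> bool -> bool -> nat -> Prop :=
| AtZero of avoids p (imps r) : row_position r p true false false 0
| AtOne of avoids p (imps r) : row_position r p false true false 1
| AtTwo of avoids p (imps r) : row_position r p false false true 2
| AtPrem c s1 s2 of imps r = s1 ++ c :: s2 & p = prem c & p \notin conc c
    & avoids p s1 & avoids p s2 : row_position r p false false false 3
| AtConc c s1 s2 of imps r = s1 ++ c :: s2 & p != prem c & p \in conc c
    & avoids p s1 & avoids p s2 :
    row_position r p false false false (4 + prem c).

Lemma avoidsP p s :
  reflect (avoids p s) (sumn [seq occurrences p c | c <- s] == 0).
Proof.
elim: s => [|c s IHs] /=; first by apply: ReflectT => c; rewrite in_nil.
rewrite addn_eq0 /occurrences addn_eq0 !eqb0.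
apply: (iffP andP) => [[/andP[pc pC] /IHs av] c'|av].
  by rewrite inE => /predU1P[->|/av].
have [-> ->] := av c (mem_head _ _); split=> //; apply/IHs => c' c's.
by apply: av; rewrite inE c's orbT.
Qed.

Lemma occurs_split p s :
  sumn [seq occurrences p c | c <- s] = 1 ->
  exists c s1 s2, [/\ s = s1 ++ c :: s2, occurrences p c = 1,
    avoids p s1 & avoids p s2].
Proof.
elim: s => [|c s IHs] //=.
case Ec: (occurrences p c) => [|[|n]] //.
  rewrite add0n => /IHs[c' [s1 [s2 [-> c'1 av1 av2]]]].
  exists c', (c :: s1), s2; split=> // x; rewrite inE => /predU1P[->|/av1 //].
  by move/eqP: Ec; rewrite /occurrences addn_eq0 !eqb0 => /andP.
by rewrite add1n => -[/eqP/avoidsP av]; exists c, [::], s.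
Qed.

Lemma filter_avoids p s :
  avoids p s -> [seq prem c | c <- s & p \in conc c] = [::].
Proof.
elim: s => [|c s IHs] //= av.
have [_ /negPf ->] := av c (mem_head _ _).
by apply: IHs => c' c's; apply: av; rewrite inE c's orbT.
Qed.

Lemma row_positionP r p :
  is_row r ->
  row_position r p (p \in zeros r) (p \in ones r) (p \in twos r) (row_code r p).
Proof.
case/is_rowP=> /(_ p) + _; rewrite /multiplicity /row_code.
case: (p \in zeros r) => /=.
  rewrite -!addnA add1n => -[/eqP]; rewrite !addn_eq0 !eqb0.
  case/andP=> /negPf -> /andP[/negPf -> /avoidsP av]; exact: AtZero.
case: (p \in ones r) => /=.
  rewrite -!addnA add0n add1n => -[/eqP]; rewrite !addn_eq0 !eqb0.
  case/andP=> /negPf -> /avoidsP av; exact: AtOne.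
case: (p \in twos r) => /=.
  rewrite !add0n add1n => -[/eqP/avoidsP av]; exact: AtTwo.
rewrite !add0n => /occurs_split[c [s1 [s2 [Er c1 av1 av2]]]].
rewrite Er filter_cat map_cat (filter_avoids av1) cat0s /=.
move: c1; rewrite /occurrences.
case: (boolP (p == prem c)) => [/eqP pc|pc];
  case: (boolP (p \in conc c)) => // pC _.
  rewrite (filter_avoids av2); exact: (AtPrem Er).
exact: (AtConc Er).
Qed.

Lemma row_code_zero r p : p \in zeros r -> row_code r p = 0.
Proof. by rewrite /row_code => ->. Qed.

Lemma row_code_one r p : is_row r -> p \in ones r -> row_code r p = 1.
Proof. by move=> rP; case: (row_positionP p rP). Qed.

Lemma row_code_two r p : is_row r -> p \in twos r -> row_code r p = 2.
Proof. by move=> rP; case: (row_positionP p rP). Qed.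

Lemma row_code_prem r c : is_row r -> c \in imps r -> row_code r (prem c) = 3.
Proof.
move=> rP cr; case: (row_positionP (prem c) rP) => //;
  try by move=> /(_ c cr)[]; rewrite eqxx.
move=> c' s1 s2 Er ne _ av1 av2.
move: cr; rewrite Er mem_cat inE => /or3P[/av1[]|/eqP cc'|/av2[]];
  rewrite ?eqxx //.
by rewrite -cc' eqxx in ne.
Qed.

Lemma row_code_conc r c p :
  is_row r -> c \in imps r -> p \in conc c -> row_code r p = 4 + prem c.
Proof.
move=> rP cr pC; case: (row_positionP p rP) => //;
  try by move=> /(_ c cr)[_]; rewrite pC.
  move=> c' s1 s2 Er _ pC' av1 av2.
  move: cr; rewrite Er mem_cat inE => /or3P[/av1[_]|/eqP cc'|/av2[_]];
    rewrite ?pC //.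
  by rewrite -cc' pC in pC'.
move=> c' s1 s2 Er _ pC' av1 av2.
move: cr; rewrite Er mem_cat inE => /or3P[/av1[_]|/eqP -> //|/av2[_]];
by rewrite ?pC.
Qed.

Lemma row_code_concP r p q :
  is_row r -> row_code r p = 4 + q ->
  exists2 c, c \in imps r & (prem c = q :> nat) /\ p \in conc c.
Proof.
move=> rP; case: (row_positionP p rP) => // c s1 s2 Er _ pC _ _ /addnI <-.
by exists c => //; rewrite Er mem_cat mem_head orbT.
Qed.

(** The position [prem c] occurs in only one entry of the list, and both pairs must be that
    entry. *)
Lemma prem_inj r : is_row r -> {in imps r &, injective (@prem w)}.
Proof.
move=> rP c c' cr c'r Ecc'.
have [_ /(_ _ cr) /set0Pn[x xC]] := is_rowP _ rP.
have := row_code_prem rP cr.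
case: (row_positionP (prem c) rP) => // c0 s1 s2 Er E0 _ av1 av2 _.
have pos d : d \in imps r -> prem c = prem d -> d = c0.
  move=> + pd; rewrite Er mem_cat inE => /or3P[/av1[]|/eqP //|/av2[]];
  by rewrite pd eqxx.
by rewrite (pos c) // (pos c').
Qed.

(** The invariant of a row with pending implication [n]; it provides the 2 at position [n] that
    every case of an imposition overwrites or keeps. *)
Definition imposable (n : nat) r : bool :=
  is_row r && [forall i : 'I_w, (n <= i) ==> (i \in twos r)].

Lemma imposableP n r :
  reflect (is_row r /\ forall i : 'I_w, n <= i -> i \in twos r)
          (imposable n r).
Proof.
by apply: (iffP andP) => -[rP /'forall_implyP r2].
Qed.

(** * Effect of one imposition on well-formedness and on the represented family *)

Section Impose.
Variables (j : 'I_w) (B : {set 'I_w}) (r : row w).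
Hypothesis ltB : forall i, i \in B -> i < j.

Lemma premise_notin : j \notin B.
Proof. by apply/negP => /ltB; rewrite ltnn. Qed.

Lemma imposable_put_zero : imposable j r -> imposable j.+1 (put_zero j r).
Proof.
case/imposableP=> rP r2; apply/imposableP; split; last first.
  by move=> i ij; rewrite !inE r2 ?(ltnW ij) // andbT -val_eqE /= gtn_eqF.
case/is_rowP: (rP) => m1 ne; apply/is_rowP; split=> // p.
have := m1 p; rewrite /multiplicity /= !inE; case: eqP => [->|] //=.
have := r2 j (leqnn j); case: (row_positionP j rP) => //.
Qed.

Lemma imposable_put_ab :
  imposable j r -> ~~ (B \subset ones r) -> B \subset ones r :|: twos r ->
  imposable j.+1 (put_ab j B r).
Proof.
case/imposableP=> rP r2 nB1 B12; apply/imposableP; split; last first.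
  move=> i ij; rewrite !inE r2 ?(ltnW ij) // andbT -val_eqE /= gtn_eqF //=.
  by apply/negP=> /ltB; rewrite ltnNge ltnW.
case/is_rowP: (rP) => m1 ne; apply/is_rowP; split=> [p|c]; last first.
  rewrite mem_rcons inE => /predU1P[-> /=|/ne //].
  (* If the new conclusion were empty, every element of [B] would carry 1. *)
  apply: contraNneq nB1 => E; apply/subsetP => x xB.
  move/subsetP/(_ x xB): B12; rewrite !inE => /orP[//|x2].
  by move/setP/(_ x): E; rewrite !inE xB x2.
have := m1 p; rewrite /multiplicity /= map_rcons -cats1 sumn_cat /= !inE.
rewrite /occurrences /= !inE.
have := r2 j (leqnn j); have := premise_notin.
case: eqP => [->|_] /=.
  by move=> /negPf ->; case: (row_positionP j rP) => //=; lia.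
by move=> _ _; case: (p \in B); case: (p \in twos r) => /=; lia.
Qed.

Lemma avoids_imps_put_ones p s :
  avoids p s ->
  avoids p [seq (prem c, conc c :\: B) : implication w
         | c <- s & (prem c \notin B) && ~~ (conc c \subset B)].
Proof.
move=> av c' /mapP[c]; rewrite mem_filter => /andP[_ /av[pc pC]] ->.
by rewrite /= inE (negPf pC) andbF.
Qed.

Lemma has_avoids p s {P : pred (implication w)}
    {Q : implication w -> {set 'I_w}} :
  avoids p s -> (forall c, p != prem c -> p \notin conc c -> p \notin Q c) ->
  has (fun c => P c && (p \in Q c)) s = false.
Proof.
move=> av PQ; apply/hasPn => c /av[pc pC].
by rewrite negb_and (PQ c) ?orbT.
Qed.

(** The new place of [p] is followed from its old one. A premise goes to the ones if it lies in [B],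
    to the twos if its whole conclusion lies in [B], and stays otherwise. An element of a conclusion
    goes to the ones if it or its premise lies in [B], and otherwise stays in the shrunken
    conclusion. *)
Lemma imposable_put_ones :
  imposable j r -> [disjoint B & zeros r] -> imposable j.+1 (put_ones j B r).
Proof.
case/imposableP=> rP r2 B0; apply/imposableP; split; last first.
  move=> i ij; rewrite !inE r2 ?(ltnW ij) // andbT -val_eqE /= gtn_eqF //=.
  by apply/orP; left; apply/negP=> /ltB; rewrite ltnNge ltnW.
case/is_rowP: (rP) => m1 ne; apply/is_rowP; split=> [p|c]; last first.
  case/mapP=> c'; rewrite mem_filter => /andP[/andP[_ nB] _] -> /=.
  by rewrite setD_eq0.
have jB := premise_notin; have j2 := r2 j (leqnn j).
have Bp0 : p \in B -> p \notin zeros r.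
  by move=> pB; rewrite (disjointFr B0 pB).
rewrite /multiplicity /= !inE !in_bigcup_seq.
have [|pj] := eqVneq p j.
  move=> ->; move: j2; case: (row_positionP j rP) => // av _.
  have /avoidsP/eqP -> := avoids_imps_put_ones av.
  rewrite (negPf jB) !(has_avoids av) //= => c; last by rewrite in_set1.
clear jB j2.
case: (row_positionP p rP) Bp0 => //=.
- move=> av Bp0; have /avoidsP/eqP -> := avoids_imps_put_ones av.
  have -> : p \in B = false by apply/negP => /Bp0.
  by rewrite !(has_avoids av) // => c; rewrite in_set1.
- move=> av _; have /avoidsP/eqP -> := avoids_imps_put_ones av.
  by rewrite !(has_avoids av) ?andbF // => c; rewrite in_set1.
- move=> av _; have /avoidsP/eqP -> := avoids_imps_put_ones av.
  rewrite !(has_avoids av) // => [|c]; last by rewrite in_set1.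
  by case: (p \in B).
- move=> c s1 s2 -> pc pC av1 av2 _.
  rewrite filter_cat !map_cat sumn_cat !has_cat.
  have /avoidsP/eqP -> := avoids_imps_put_ones av1.
  rewrite !(has_avoids av1) //; last by move=> ? ?; rewrite in_set1.
  rewrite /= !(has_avoids av2) //; last by move=> ? ?; rewrite in_set1.
  rewrite in_set1 -pc eqxx (negPf pC) andbF.
  have /avoidsP/eqP sum2 := avoids_imps_put_ones av2.
  case: (p \in B) => //=; first by rewrite sum2.
  case: (conc c \subset B) => //=; rewrite sum2 //.
  by rewrite /occurrences /= inE -pc eqxx (negPf pC) andbF.
move=> c s1 s2 -> pc pC av1 av2 _.
rewrite filter_cat !map_cat sumn_cat !has_cat.
have /avoidsP/eqP -> := avoids_imps_put_ones av1.
rewrite !(has_avoids av1) //; last by move=> ? ?; rewrite in_set1.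
rewrite /= !(has_avoids av2) //; last by move=> ? ?; rewrite in_set1.
rewrite in_set1 pC (negPf pc) andbF !andbT.
case: (prem c \in B) => //=.
  have /avoidsP/eqP -> := avoids_imps_put_ones av2.
  by rewrite !orbT.
case: (boolP (conc c \subset B)) => [/subsetP/(_ p pC) pB|] /=.
  by have /avoidsP/eqP -> := avoids_imps_put_ones av2; rewrite pB.
have /avoidsP/eqP -> := avoids_imps_put_ones av2.
by rewrite /occurrences /= inE (negPf pc) pC; case: (p \in B).
Qed.

Lemma imposable_impose :
  imposable j r -> all (imposable j.+1) (impose j B r).
Proof.
move=> rI; rewrite /impose.
case: ifP => [_|/negbFE B0]; first by rewrite all_seq1 imposable_put_zero.
case: ifP => [_|/negbT B1].
  case/imposableP: rI => rP r2; rewrite all_seq1; apply/imposableP.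
  by split=> // i ij; apply: r2 (ltnW ij).
case: ifP => [B12|_]; first by rewrite all_seq1 imposable_put_ab.
by rewrite /= imposable_put_zero // imposable_put_ones.
Qed.

Lemma in_family_put_zero X :
  (X \in row_family (put_zero j r)) = (X \in row_family r) && (j \notin X).
Proof.
rewrite !inE /= !disjoints_subset subUset sub1set in_setC -!andbA.
by congr (_ && _); rewrite [RHS]andbA [RHS]andbC.
Qed.

(** Elements of [B] carrying 1 are in [X] anyway, so the shortened conclusion [B :&: twos r] says
    the same as [B]. *)
Lemma in_family_put_ab X :
  B \subset ones r :|: twos r ->
  (X \in row_family (put_ab j B r)) =
  (X \in row_family r) && ((j \in X) ==> (B \subset X)).
Proof.
move=> B12; rewrite !inE /= all_rcons /= sub1set -!andbA.
case: (boolP (ones r \subset X)) => //= X1; congr (_ && _).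
rewrite andbC; congr (_ && (_ ==> _)).
apply/idP/idP => [B2X|]; last exact: subset_trans (subsetIl _ _).
apply/subsetP => x xB; move/subsetP/(_ x xB): (B12); rewrite !inE.
case/orP=> [/(subsetP X1)//|x2]; apply: (subsetP B2X).
by rewrite inE xB.
Qed.

(** Once [B] is contained in [X], each pair simplifies separately: a premise in [B] forces its
    conclusion, a conclusion inside [B] holds automatically, and in the remaining case only
    [conc c :\: B] still has to be checked. *)
Lemma in_family_put_ones X :
  (X \in row_family (put_ones j B r)) =
  [&& X \in row_family r, j \in X & B \subset X].
Proof.
rewrite !inE /= !subUset sub1set -!andbA.
case: (ones r \subset X) => //=.
case: (j \in X) => //=; rewrite ?andbF //.
case: (boolP (B \subset X)) => BX /=; rewrite ?andbF // andbT.
rewrite [LHS]andbCA; congr (_ && _).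
elim: (imps r) => [|c s IHs] /=; first by rewrite big_nil sub0set.
rewrite big_cons -IHs sub1set.
case: (boolP (prem c \in B)) => [pB|pB] /=.
  by rewrite (subsetP BX _ pB) subUset /= -andbA.
case: (boolP (conc c \subset B)) => [CB|CB] /=.
  by rewrite (subset_trans CB BX) implybT.
rewrite sub1set andbCA; congr ((_ ==> _) && _).
by rewrite subDset (setUidPr BX).
Qed.

(** Counting the resulting rows that contain [X] yields covering and disjointness together. A zero
    in [B] forbids [j], [B] inside the ones makes the implication automatic, and the split of the
    last case is by whether [j] belongs to [X]. *)
Lemma count_impose X :
  count (fun r' => X \in row_family r') (impose j B r) =
  (X \in row_family r) && ((j \in X) ==> (B \subset X)).
Proof.
rewrite /impose; case: ifP => [B0|_].
  rewrite /= addn0 in_family_put_zero; congr nat_of_bool.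
  case: (boolP (X \in row_family r)) => //=; rewrite inE => /and3P[_ X0 _].
  case: (j \in X) => //=; apply/esym/negP => BX.
  by rewrite disjoint_sym (disjointWr BX X0) in B0.
case: ifP => [B1|/negbT B1].
  rewrite /= addn0; case: (boolP (X \in row_family r)) => //=.
  by rewrite inE => /andP[/(subset_trans B1) -> _]; rewrite implybT.
case: ifP => [B12|_]; first by rewrite /= addn0 in_family_put_ab.
rewrite /= addn0 in_family_put_zero in_family_put_ones.
by case: (X \in row_family r) => //=; case: (j \in X).
Qed.

End Impose.
End Rows.

(** * The run of the algorithm *)

Section Algorithm.
Variables (w : nat) (lc : 'I_w -> {set 'I_w}).
Hypothesis lc_lt : forall j i, i \in lc j -> i < j.

Definition obeys_from (n : nat) (X : {set 'I_w}) : bool :=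
  [forall j : 'I_w, (n <= j) ==> (j \in X) ==> (lc j \subset X)].

Lemma obeys_from_recl (j : 'I_w) X :
  obeys_from j X = ((j \in X) ==> (lc j \subset X)) && obeys_from j.+1 X.
Proof.
apply/'forall_implyP/andP => [obX|[obj /'forall_implyP obX] i].
  split; first exact: obX.
  by apply/'forall_implyP => i /ltnW; apply: obX.
by rewrite leq_eqVlt => /predU1P[/val_inj <- //|]; apply: obX.
Qed.

(** The rows [L], all pending at [n] and on top of the stack, are turned into the final rows [G] in
    [m] steps, whatever lies below them. The factor [(w - n).+1] counts the remaining impositions
    and the move to the final stack; the last clause is multiplicative so that blocks of rows can be
    added up. *)
Definition processed (n : nat) (L : seq (row w)) (m : nat) (G : seq (row w)) :
    Prop :=
  [/\ forall rest F,
        iter m (ab_step lc) ([seq (n, r) | r <- L] ++ rest, F) = (rest, F ++ G),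
      size L <= size G,
      m <= size G * (w - n).+1,
      all (@is_row w) G
    & forall X, count (fun r => X \in row_family r) G =
                count (fun r => X \in row_family r) L * obeys_from n X].

(** By the last in, first out discipline, [r] and all its descendants are finished before [L] is
    touched; steps and final rows therefore add up. *)
Lemma processed_cons n r L m1 m2 G1 G2 :
  processed n [:: r] m1 G1 -> processed n L m2 G2 ->
  processed n (r :: L) (m2 + m1) (G1 ++ G2).
Proof.
case=> run1 size1 le1 row1 fam1 [run2 size2 le2 row2 fam2]; split.
- by move=> rest F; rewrite iterD (run1 (_ ++ rest)) run2 catA.
- by rewrite size_cat; apply: leq_add size1 size2.
- by rewrite size_cat mulnDl addnC leq_add.
- by rewrite all_cat row1.
by move=> X; rewrite count_cat fam1 fam2 /= addn0 mulnDl.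
Qed.

Lemma process_all n L :
  (forall r, imposable n r -> exists m G, processed n [:: r] m G) ->
  all (imposable n) L -> exists m G, processed n L m G.
Proof.
move=> one; elim: L => [_|r L IHL /= /andP[/one[m1 [G1 p1]] /IHL[m2 [G2 p2]]]].
  by exists 0, [::]; split=> // rest F; rewrite cats0.
by exists (m2 + m1), (G1 ++ G2); apply: processed_cons.
Qed.

Lemma process_row n r :
  n <= w -> imposable n r -> exists m G, processed n [:: r] m G.
Proof.
(* The induction runs over the number of implications still to be imposed. *)
move=> le_nw; rewrite -(subKn le_nw); elim: (w - n) (leq_subr n w) r => {n le_nw}.
  move=> _ r; rewrite subn0 => /imposableP[rP _]; exists 1, [:: r]; split=> //=.
  - by move=> rest F; rewrite insubF ?ltnn // cats1.
  - by rewrite rP.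
  move=> X; rewrite addn0 (_ : obeys_from w X) ?muln1 //.
  by apply/'forall_implyP => j; rewrite leqNgt ltn_ord.
move=> n IHn lt_nw r rI.
have lt_jw : w - n.+1 < w by lia.
pose j := Ordinal lt_jw.
have jE : j.+1 = w - n by rewrite /=; lia.
have := imposable_impose (@lc_lt j) rI; rewrite jE.
case/(process_all (IHn (ltnW lt_nw))) => m [G [run sz le rows fam]].
exists m.+1, G; split=> //.
- by move=> rest F; rewrite iterSr /= insubT /= -run -jE.
- apply: leq_trans sz; rewrite /impose; do 3!case: ifP => // _.
- rewrite subKn //; rewrite subKn ?(ltnW lt_nw) // in le.
  (* The extra step is paid for by one final row, which exists because an imposition never returns
     an empty list. *)
  have : 0 < size G; last by nia.
  by apply: leq_trans sz; rewrite /impose; do 3!case: ifP => // _.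
move=> X; rewrite fam count_impose -/(nat_of_ord j) (obeys_from_recl j) jE /= addn0.
by rewrite -!mulnb mulnA.
Qed.

End Algorithm.

(** * Order ideals as the sets obeying all lower-cover implications *)

Section OrderIdeals.
Variables (d : Order.disp_t) (T : finPOrderType d) (w : nat) (lab : 'I_w -> T).
Hypothesis lab_ext : linear_extension lab.

Let lab_lt (i j : 'I_w) : (lab i < lab j)%O -> i < j.
Proof.
move=> lt_ij; rewrite ltn_neqAle (lab_ext.2 _ _ (Order.POrderTheory.ltW lt_ij)).
by rewrite andbT; apply: contraTneq lt_ij => /val_inj ->; rewrite Order.POrderTheory.ltxx.
Qed.

Lemma LC_lt (j i : 'I_w) : i \in LC lab j -> i < j.
Proof. by rewrite inE => /andP[/lab_lt]. Qed.

(** Among the elements in the interval from [lab i] up to, but excluding, [lab j], the one with the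
    largest number is a lower cover: anything strictly between it and [lab j] would have a larger
    number. *)
Lemma lower_cover_above (i j : 'I_w) :
  (lab i < lab j)%O -> exists2 k, k \in LC lab j & (lab i <= lab k)%O.
Proof.
move=> lt_ij; pose P k := (lab i <= lab k)%O && (lab k < lab j)%O.
have Pi : P i by rewrite /P Order.POrderTheory.lexx.
case: (arg_maxnP (fun k : 'I_w => k : nat) Pi) => k /andP[le_ik lt_kj] maxk.
exists k => //; rewrite inE lt_kj; apply/forallP => x; apply/negP.
case: lab_ext => -[inv _ invK] _; rewrite -[x]invK => /andP[lt_kx lt_xj].
have := maxk (inv x); rewrite /P lt_xj.
rewrite (Order.POrderTheory.ltW (Order.POrderTheory.le_lt_trans le_ik lt_kx)).
by move=> /(_ isT) /=; rewrite leqNgt => /negP; apply; apply: lab_lt.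
Qed.

Lemma order_idealE (X : {set 'I_w}) :
  order_ideal (lab @: X) = obeys_from (LC lab) 0 X.
Proof.
have [[inv labK invK] _] := lab_ext; have lab_inj := can_inj labK.
apply/'forall_implyP/'forall_implyP => [idX j _|obX x].
  apply/implyP => jX; apply/subsetP => i; rewrite inE => /andP[lt_ij _].
  have /forallP/(_ (lab i)) := idX _ (imset_f lab jX).
  by rewrite (Order.POrderTheory.ltW lt_ij) (mem_imset _ _ lab_inj).
rewrite -[x]invK mem_imset //; move: (inv x) => j {x} jX.
apply/forallP => y; rewrite -[y]invK mem_imset //; move: (inv y) => i {y}.
(* Strong induction on [j]: an element strictly below [j] lies below some lower cover of [j], which
   belongs to [X] and has a smaller number. *)
have [n] := ubnP (j : nat); elim: n => // n IHn in j jX *; rewrite ltnS => le_jn.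
apply/implyP; rewrite Order.POrderTheory.le_eqVlt.
case/predU1P => [/lab_inj -> //|/lower_cover_above[k kj le_ik]].
have /implyP/(_ jX)/subsetP/(_ k kj) kX := obX j (leq0n j).
by have /implyP := IHn k kX (leq_trans (LC_lt kj) le_jn); apply.
Qed.

(** The initial row represents all sets, so a set lies in exactly one final family if it is an ideal
    and in none otherwise. Positivity of this count gives the union, its bound by 1 the
    disjointness. *)
Lemma ab_algorithm_correct :
  exists m F,
    [/\ iter m (ab_step (LC lab)) (init_config w) = ([::], F),
        0 < size F /\ m <= size F * w.+1,
        all (@is_row w) F,
        \bigcup_(r <- F) row_family r
          = [set X : {set 'I_w} | order_ideal (lab @: X)]
      & pairwise (fun r1 r2 : row w => [disjoint row_family r1 & row_family r2]) F].
Proof.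
have initI : imposable 0 (Row set0 set0 [set: 'I_w] [::]).
  apply/imposableP; split=> [|i _]; last by rewrite inE.
  by apply/is_rowP; split=> // p; rewrite /multiplicity !inE.
have [m [F [run sz le rows fam]]] := process_row LC_lt (leq0n w) initI.
have famE X : count (fun r => X \in row_family r) F = order_ideal (lab @: X).
  rewrite fam order_idealE /= addn0 inE /= sub0set !andbT.
  by rewrite disjoint_sym disjoint_sym disjoints_subset sub0set mul1n.
exists m, F; split=> //.
- by have := run [::] [::].
- by rewrite subn0 in le.
- by apply/setP => X; rewrite in_bigcup_seq inE has_count famE; case: order_ideal.
rewrite -(pairwise_map (@row_family w) (fun A B => [disjoint A & B])).
rewrite pairwise_disjointE.
by apply/forallP => X; rewrite count_map famE leq_b1.
Qed.

End OrderIdeals.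

(** * The program without its main loop, as a function on states *)

(** [While] is given the meaning it has at the head of [for_all_positions]. *)
Fixpoint denote (c : cmd) (s : state) : state :=
  match c with
  | Skip => s
  | Assign x e => set_reg s x (eval s e)
  | Store a e1 e2 e => set_cell s a (eval s e1) (eval s e2) (eval s e)
  | Seq c1 c2 => denote c2 (denote c1 s)
  | If e c1 c2 => if eval s e == 0 then denote c2 s else denote c1 s
  | While _ c => iter (regs s rW - regs s rI) (denote c) s
  end.

(** An overestimate that needs no state: both branches of a test are charged, and a loop is charged
    [w] rounds plus its failing test. *)
Fixpoint time_bound (w : nat) (c : cmd) : nat :=
  match c with
  | Skip => 1
  | Assign x e => (cost e).+1
  | Store a e1 e2 e => (cost e1 + cost e2 + cost e).+1
  | Seq c1 c2 => time_bound w c1 + time_bound w c2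
  | If e c1 c2 => (cost e + time_bound w c1 + time_bound w c2).+1
  | While e c => w * (cost e + time_bound w c).+1 + (cost e).+1
  end.

Fixpoint assigns (c : cmd) (x : reg) : bool :=
  match c with
  | Skip | Store _ _ _ _ => false
  | Assign y _ => reg_beq x y
  | Seq c1 c2 | If _ c1 c2 => assigns c1 x || assigns c2 x
  | While _ c => assigns c x
  end.

Fixpoint stores (c : cmd) (a : arr) : bool :=
  match c with
  | Skip | Assign _ _ => false
  | Store b _ _ _ => arr_beq a b
  | Seq c1 c2 | If _ c1 c2 => stores c1 a || stores c2 a
  | While _ c => stores c a
  end.

(** Programs whose only loops are sweeps. Since [rW] is never assigned and a body never touches
    [rI], each sweep makes exactly as many rounds as [rW] says, and sweeps cannot be nested. *)
Inductive sweeping : cmd -> Prop :=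
| SweepSkip : sweeping Skip
| SweepAssign x e : ~~ reg_beq rW x -> sweeping (Assign x e)
| SweepStore a e1 e2 e : sweeping (Store a e1 e2 e)
| SweepFor c : sweeping c -> ~~ assigns c rI -> sweeping (for_all_positions c)
| SweepSeq c1 c2 : sweeping c1 -> sweeping c2 -> sweeping (Seq c1 c2)
| SweepIf e c1 c2 : sweeping c1 -> sweeping c2 -> sweeping (If e c1 c2).

Lemma denote_regs c s x : ~~ assigns c x -> regs (denote c s) x = regs s x.
Proof.
elim: c s => //= [y e|c1 IH1 c2 IH2|e c1 IH1 c2 IH2|e c IHc] s.
- by move/negPf => ->.
- by rewrite negb_or => /andP[n1 n2]; rewrite IH2 ?IH1.
- by rewrite negb_or => /andP[n1 n2]; case: ifP; rewrite ?IH1 ?IH2.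
by move=> nx; elim: (_ - _) => //= n <-; apply: IHc.
Qed.

Lemma denote_cells c s a m n :
  ~~ stores c a -> cells (denote c s) a m n = cells s a m n.
Proof.
elim: c s => //= [b e1 e2 e|c1 IH1 c2 IH2|e c1 IH1 c2 IH2|e c IHc] s.
- by move/negPf => ->.
- by rewrite negb_or => /andP[n1 n2]; rewrite IH2 ?IH1.
- by rewrite negb_or => /andP[n1 n2]; case: ifP; rewrite ?IH1 ?IH2.
by move=> nx; elim: (_ - _) => //= k <-; apply: IHc.
Qed.

Lemma sweeping_rW c : sweeping c -> ~~ assigns c rW.
Proof.
elim=> //= [c' _ H _|c1 c2 _ H1 _ H2|_ c1 c2 _ H1 _ H2];
  by rewrite ?orbF ?negb_or ?H1 ?H2.
Qed.

Lemma exec_sweeping c s :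
  sweeping c -> exists2 t, exec s c t (denote c s) & t <= time_bound (regs s rW) c.
Proof.
move=> sw; elim: sw s => {c} [|x e _|a e1 e2 e|c sw IHc nI|c1 c2 sw1 IH1 _ IH2|
    e c1 c2 _ IH1 _ IH2] s.
- by exists 1 => //; constructor.
- by exists (cost e).+1 => //; constructor.
- by exists (cost e1 + cost e2 + cost e).+1 => //; constructor.
(* Here [n] is the number of rounds left. Besides its body, a round costs 8 units: 3 for the
   condition, 1 for the loop and 4 for the increment; the failing test costs 4. *)
- have loop n s0 : regs s0 rI + n = regs s0 rW ->
      exists2 t, exec s0 (While (Ltn rI rW) (Seq c (Assign rI (Add rI 1)))) t
        (iter n (denote (Seq c (Assign rI (Add rI 1)))) s0)
      & t <= n * (time_bound (regs s0 rW) c + 8) + 4.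
    elim: n s0 => [|n IHn] s0 E.
      exists 4 => //; apply: (ExecWhileFalse (s := s0) (e := Ltn rI rW)).
      by rewrite /= -E addn0 ltnn.
    have [t1 ex1 le1] := IHc s0.
    set s1 := denote (Seq c (Assign rI (Add rI 1))) s0.
    have W1 : regs s1 rW = regs s0 rW by rewrite /= denote_regs // sweeping_rW.
    have I1 : regs s1 rI = (regs s0 rI).+1 by rewrite /= denote_regs // addn1.
    have [|t2 ex2 le2] := IHn s1; first by rewrite I1 W1; lia.
    rewrite iterSr; exists (cost (Ltn rI rW) + (t1 + 4) + t2).+1.
      apply: ExecWhileTrue ex2; first by rewrite /= -E -[X in X < _]addn0 ltn_add2l.
      apply: ExecSeq ex1 _; apply: (ExecAssign _ _ (Add rI 1)).
    by rewrite W1 in le2; rewrite /=; lia.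
  have [t ex le] := loop (regs s rW) (set_reg s rI 0) (add0n _).
  exists (2 + t); last by rewrite /= in le *; lia.
  apply: ExecSeq (ExecAssign _ _ _) _.
  by rewrite /= subn0; exact: ex.
- have [t1 ex1 le1] := IH1 s; have [t2 ex2 le2] := IH2 (denote c1 s).
  exists (t1 + t2); first exact: ExecSeq ex1 ex2.
  by rewrite denote_regs ?sweeping_rW // in le2; apply: leq_add.
have [t1 ex1 le1] := IH1 s; have [t2 ex2 le2] := IH2 s.
rewrite /=; case: eqP => [E|/eqP E].
  by exists (cost e + t2).+1; [exact: ExecIfFalse | lia].
by exists (cost e + t1).+1; [exact: ExecIfTrue | lia].
Qed.

(** * Invariant rules for sweeps over the positions *)

Lemma arr_beqP a b : reflect (a = b) (arr_beq a b).
Proof. by case: a; case: b; constructor. Qed.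

(** [P k] is the loop invariant at the head of round [k]. The frame facts available in the step are
    carried along by the induction, so each use only has to treat what the body changes. *)
Lemma denote_for (P : nat -> state -> Prop) c s :
  ~~ assigns c rI -> ~~ assigns c rW ->
  P 0 (set_reg s rI 0) ->
  (forall k s', k < regs s rW -> regs s' rI = k ->
     (forall x, ~~ (reg_beq x rI || assigns c x) -> regs s' x = regs s x) ->
     (forall a m n, ~~ stores c a -> cells s' a m n = cells s a m n) ->
     P k s' -> P k.+1 (set_reg (denote c s') rI k.+1)) ->
  P (regs s rW) (denote (for_all_positions c) s).
Proof.
move=> nI nW P0 PS; rewrite /= subn0.
set f := fun s => _; set s0 := set_reg s rI 0.
suff: forall k, k <= regs s rW ->
  [/\ regs (iter k f s0) rI = k,
      forall x, ~~ (reg_beq x rI || assigns c x) -> regs (iter k f s0) x = regs s x,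
      forall a m n, ~~ stores c a -> cells (iter k f s0) a m n = cells s a m n
    & P k (iter k f s0)] by case/(_ _ (leqnn _)).
elim=> [_|k IHk lt_kw].
  by split=> // x; rewrite negb_or /= => /andP[/negPf -> _].
have [Ik Rk Ck Pk] := IHk (ltnW lt_kw).
rewrite iterS; move: (iter k f s0) Ik Rk Ck Pk => s' Ik Rk Ck Pk.
have -> : f s' = set_reg (denote c s') rI k.+1.
  by rewrite /f denote_regs // Ik addn1.
split=> //; last exact: PS.
  move=> x nx; rewrite /= -(Rk x nx); move: nx.
  by rewrite negb_or => /andP[/negPf -> /denote_regs ->].
by move=> a m n na; rewrite /= denote_cells // Ck.
Qed.

(** The rule for sweeps that in each round write at most the cell at the counter in line [m0] of
    [a0]. Cells not yet reached still have their initial contents, so [v] can be expressed by the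
    state before the sweep. *)
Lemma denote_fill a0 m0 v c s :
  ~~ assigns c rI -> ~~ assigns c rW ->
  (forall s', regs s' rI < regs s rW ->
     (forall x, ~~ (reg_beq x rI || assigns c x) -> regs s' x = regs s x) ->
     (forall a m n, ~~ [&& arr_beq a a0, m == m0 & n < regs s' rI] ->
        cells s' a m n = cells s a m n) ->
     cells (denote c s') a0 m0 (regs s' rI) = v (regs s' rI) /\
     forall a m n, ~~ [&& arr_beq a a0, m == m0 & n == regs s' rI] ->
       cells (denote c s') a m n = cells s' a m n) ->
  forall a m n, cells (denote (for_all_positions c) s) a m n =
    if [&& arr_beq a a0, m == m0 & n < regs s rW] then v n else cells s a m n.
Proof.
move=> nI nW step.
apply: (denote_for (P := fun k s' => forall a m n, cells s' a m n =
  if [&& arr_beq a a0, m == m0 & n < k] then v n else cells s a m n)) => //.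
  by move=> a m n; rewrite !andbF.
move=> k s' lt_kw Ik Rk _ Pk a m n.
have [||here elsewhere] := step s' _ Rk _; rewrite ?Ik //.
  by move=> a' m' n' /negPf; rewrite Pk => ->.
rewrite Ik in here elsewhere.
rewrite [LHS]/= [n < k.+1]ltnS [n <= k]leq_eqVlt.
case: (boolP [&& arr_beq a a0, m == m0 & n == k]) => [|off].
  by case/and3P=> /arr_beqP -> /eqP -> /eqP ->; rewrite here !eqxx; case: arr_beqP.
rewrite elsewhere // Pk; move: off.
by case: (arr_beq _ _) => //=; case: (m == m0) => //= /negPf ->.
Qed.

(** * The program follows the algorithm *)

Section Machine.
Variables (w : nat) (lc : 'I_w -> {set 'I_w}).
Hypothesis lc_lt : forall j i, i \in lc j -> i < j.

Lemma exists_ltnS k (lt_kw : k < w) (Q : pred 'I_w) :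
  [exists p : 'I_w, (p < k.+1) && Q p] =
  [exists p : 'I_w, (p < k) && Q p] || Q (Ordinal lt_kw).
Proof.
apply/existsP/orP => [[p]|[/existsP[p /andP[lt_pk Qp]]|Qk]].
- rewrite ltnS leq_eqVlt => /andP[/predU1P[pk|lt_pk] Qp]; [right|left].
    by rewrite (_ : Ordinal _ = p) //; apply: val_inj.
  by apply/existsP; exists p; rewrite lt_pk.
- by exists p; rewrite ltnW.
by exists (Ordinal lt_kw); rewrite /= leqnn.
Qed.

Lemma exists_lt0 (Q : pred 'I_w) : [exists p : 'I_w, (p < 0) && Q p] = false.
Proof. by apply/existsP => -[]. Qed.

Lemma exists_ltw (Q : pred 'I_w) :
  [exists p : 'I_w, (p < w) && Q p] = [exists p, Q p].
Proof. by apply: eq_existsb => p; rewrite ltn_ord. Qed.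

Lemma denote_seq c1 c2 s : denote (Seq c1 c2) s = denote c2 (denote c1 s).
Proof. by []. Qed.

(** * The cases of an imposition carried out in memory *)

Definition codes (s : state) (k : nat) (r : row w) : Prop :=
  forall p : 'I_w, cells s Stk k p = row_code r p.

Definition focused (s : state) (j : 'I_w) (r : row w) : Prop :=
  [/\ input_state lc s, regs s rJ = j & codes s (regs s rD) r].

Lemma input_state_denote c s :
  ~~ assigns c rW -> ~~ stores c LCm ->
  input_state lc s -> input_state lc (denote c s).
Proof.
move=> nW nL [W L]; split; first by rewrite denote_regs.
by move=> i j; rewrite denote_cells.
Qed.

Lemma denote_scan s j r (B := lc j)
    (flag := fun q : pred nat => [exists p, (p \in B) && q (row_code r p)])
    (s' := denote prog_scan s) :
  focused s j r ->
  [/\ regs s' rZero = flag (fun v => v == 0),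
      regs s' rTwo = flag (fun v => v == 2) & regs s' rAB = flag (fun v => 2 < v)].
Proof.
case=> -[W L] J codes_r.
pose upto k (q : pred nat) :=
  [exists p : 'I_w, (p < k) && ((p \in B) && q (row_code r p))].
pose P k s' := [/\ regs s' rZero = upto k (fun v => v == 0),
  regs s' rTwo = upto k (fun v => v == 2) & regs s' rAB = upto k (fun v => 2 < v)].
suff: P (regs s rW) s' by rewrite W /P /upto !exists_ltw.
rewrite /s' /prog_scan 3!denote_seq; set s0 := denote (Assign rAB _) _.
apply: (@denote_for P _ s0) => //.
  by rewrite /P /upto !exists_lt0.
move=> k s1; rewrite [regs _ rW]/= W => lt_kw I1 R1 C1 [Z1 T1 A1].
rewrite /P /upto !(exists_ltnS lt_kw) -!/(upto _ _).
rewrite /= (R1 rJ) // (R1 rD) // I1 !C1 // [regs s0 rJ]J -[regs s0 rD]/(regs s rD).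
have -> : cells s LCm j k = (Ordinal lt_kw \in B) := L (Ordinal lt_kw) j.
have -> : cells s Stk (regs s rD) k = row_code r (Ordinal lt_kw) :=
  codes_r (Ordinal lt_kw).
case: (_ \in B) => /=; last by rewrite !orbF.
by case: (row_code r _) => [|[|[|v]]] /=; rewrite ?Z1 ?T1 ?A1 ?orbF ?orbT.
Qed.

Definition restacks (s s' : state) (k : nat) (r : row w) : Prop :=
  codes s' k r /\
  forall k' m, k' != k -> cells s' Stk k' m = cells s Stk k' m.

Lemma row_code_put_zero j r (p : 'I_w) :
  row_code (put_zero j r) p = if p == j then 0 else row_code r p.
Proof. by rewrite /row_code /= !inE; case: eqP. Qed.

Lemma denote_put_zero s j r :
  focused s j r -> restacks s (denote prog_put_zero s) (regs s rD) (put_zero j r).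
Proof.
move=> [_ J codes_r]; split=> [p|k m /negPf nD]; last by rewrite /= nD.
rewrite /= eqxx J /= val_eqE.
by rewrite codes_r row_code_put_zero.
Qed.

Lemma denote_put_ab s j r (B := lc j) :
  focused s j r -> imposable j r -> is_row (put_ab j B r) ->
  B \subset ones r :|: twos r ->
  restacks s (denote prog_put_ab s) (regs s rD) (put_ab j B r).
Proof.
case=> -[W L] J codes_r /imposableP[rP r2] rP' B12.
set D := regs s rD.
pose v n := if (cells s LCm j n != 0) && (cells s Stk D n == 2) then 4 + j
            else cells s Stk D n.
set c := when in_B (when (Eqn (Cell Stk rD rI) 2) (Store Stk rD rI (Add 4 rJ))).
have fill : forall a m n, cells (denote (for_all_positions c) s) a m n =
    if [&& arr_beq a Stk, m == D & n < regs s rW] then v n else cells s a m n.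
  apply: denote_fill => // s1 lt_iw R1 C1.
  have DE : regs s1 rD = D by rewrite R1.
  have JE : regs s1 rJ = j by rewrite R1.
  have LE i : cells s1 LCm j i = cells s LCm j i by rewrite C1.
  have SE : cells s1 Stk D (regs s1 rI) = cells s Stk D (regs s1 rI).
    by rewrite C1 // ltnn !andbF.
  rewrite /= DE JE LE SE /v; split=> [|a m n /negPf off].
    by case: (cells s LCm _ _ == 0) => //=; case: (_ == 2); rewrite /= ?eqxx ?SE.
  by do 2!case: ifP => // _; rewrite /= off.
rewrite [denote _ s]/(set_cell (denote (for_all_positions c) s) _ _ _ _).
set s1 := denote _ _ in fill *; have DE : regs s1 rD = D by rewrite /s1 denote_regs.
have JE : regs s1 rJ = j by rewrite /s1 denote_regs.
split=> [p|k m /negPf nD]; last by rewrite /= DE nD fill nD andbF.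
rewrite /= DE JE eqxx fill /= eqxx W ltn_ord /= /v L codes_r.
clear fill v c s1 DE JE.
set r' := put_ab j B r in rP' *.
(* In a well-formed row any pair containing a position determines its code; hence it suffices that
   the old pairs survive and the new one is present. *)
have newI : (j, B :&: twos r) \in imps r' by rewrite mem_rcons mem_head.
have oldI c : c \in imps r -> c \in imps r' by rewrite mem_rcons inE orbC => ->.
have [/val_inj -> | pj] := eqVneq (p : nat) j.
  by rewrite -(row_code_prem rP' newI).
case pB: (p \in B) => /=; first case: eqP => [p2|/eqP p2].
- rewrite (row_code_conc rP' newI) //= inE pB.
  by move: p2; case: (row_positionP p rP).
- move/subsetP/(_ p pB): B12; rewrite !inE => /orP[p1|p2'].
    by rewrite (row_code_one rP p1) (row_code_one rP').
  by rewrite (row_code_two rP p2') in p2.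
case: (boolP (p \in zeros r)) => [p0|n0]; first by rewrite !row_code_zero.
case: (boolP (p \in ones r)) => [p1|n1]; first by rewrite !row_code_one.
case: (boolP (p \in twos r)) => [p2|n2].
  by rewrite !row_code_two // !inE p2 pB -val_eqE (negPf pj).
move: n0 n1 n2; case: (row_positionP p rP) => // c s1 s2 Ec pc pC _ _ _ _ _.
  by rewrite pc (row_code_prem rP') // oldI // Ec mem_cat mem_head orbT.
by rewrite (row_code_conc rP' (c := c)) // oldI // Ec mem_cat mem_head orbT.
Qed.

(** The formula mirrors the program: [f] is the code after all changes to 1, and a symbol a left
    without any b then becomes 2. *)
Lemma row_code_put_ones j r (B := lc j)
    (f := fun p : 'I_w =>
       if [|| p == j, p \in B | [exists q in B, row_code r p == 4 + q]] then 1
       else row_code r p) :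
  imposable j r -> [disjoint B & zeros r] -> is_row (put_ones j B r) ->
  forall p, row_code (put_ones j B r) p =
    if (f p == 3) && ~~ [exists i, f i == 4 + p] then 2 else f p.
Proof.
case/imposableP=> rP r2 B0 rP' p.
have jB : j \notin B by apply: premise_notin (@lc_lt j).
have Bp0 i : i \in zeros r -> i \in B = false by move=> i0; rewrite (disjointFl B0).
have [p1|] := boolP [|| p == j, p \in B | [exists q in B, row_code r p == 4 + q]].
  rewrite {1 3}/f p1 /= row_code_one // !inE in_bigcup_seq.
  case/or3P: p1 => [-> | -> | /exists_inP[q qB /eqP Eq]]; rewrite ?orbT //.
  have [c cr [/val_inj Ec pC]] := row_code_concP rP Eq.
  rewrite orbC; have -> //: has (fun c => (prem c \in B) && (p \in conc c)) (imps r).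
  by apply/hasP; exists c => //; rewrite Ec qB.
move=> n1; have -> : f p = row_code r p by rewrite /f (negPf n1).
move: n1; rewrite !negb_or negb_exists_in => /and3P[pj pB /forall_inP nq].
have keep c : c \in imps r -> prem c \notin B -> ~~ (conc c \subset B) ->
    (prem c, conc c :\: B) \in imps (put_ones j B r).
  by move=> cr cB CB; apply/mapP; exists c => //; rewrite mem_filter cB CB.
have [p0|n0] := boolP (p \in zeros r); first by rewrite !row_code_zero.
have [p1|n1] := boolP (p \in ones r); first by rewrite !row_code_one // !inE p1.
have [p2|n2] := boolP (p \in twos r).
  by rewrite !row_code_two // !inE p2 (negPf pj) (negPf pB).
move: n0 n1 n2 nq; case: (row_positionP p rP) => //
  [c s1 s2 Er pc pC _ _ _ _ _ _ | c s1 s2 Er pc pC _ _ _ _ _ nq] /=.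
- have cr : c \in imps r by rewrite Er mem_cat mem_head orbT.
  case: (boolP (conc c \subset B)) => CB.
    (* By injectivity of premises, a b referring to [p] belongs to [c], hence lies in [B] and has
       already become 1. *)
    have -> /= : ~~ [exists i, f i == 4 + p].
      apply/existsP => -[i]; rewrite /f; case: ifP => // /negbT.
      rewrite !negb_or => /and3P[_ iB _] /eqP Ei.
      have [c' c'r [/val_inj Ec iC]] := row_code_concP rP Ei.
      rewrite pc in Ec; have E := prem_inj rP c'r cr Ec.
      by move/subsetP/(_ i): CB; rewrite -E iC (negPf iB) => /(_ isT).
    rewrite row_code_two // !inE in_bigcup_seq orbC.
    have -> // : has (fun c => (prem c \notin B) && (conc c \subset B) &&
                               (p \in [set prem c])) (imps r).
    by apply/hasP; exists c => //; rewrite CB -pc pB in_set1 eqxx.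
  have ex : [exists i, f i == 4 + p].
    (* An element of the conclusion outside [B] keeps its b: it is not [j], which carries 2, and its
       premise [p] is not in [B]. *)
    have /subsetPn[i iC iB] := CB; apply/existsP; exists i.
    have Ei := row_code_conc rP cr iC; rewrite /f ifN; first by rewrite Ei pc.
    rewrite !negb_or iB negb_exists_in; apply/and3P; split=> //.
      by apply: contraTneq (r2 j (leqnn j)) => <-; case: row_positionP Ei.
    apply/forall_inP => q qB; rewrite Ei eqn_add2l val_eqE.
    by apply: contraNneq pB; rewrite pc => ->.
  by rewrite ifN ?negbK // pc -(row_code_prem rP' (keep c cr _ CB)) // -pc.
have cr : c \in imps r by rewrite Er mem_cat mem_head orbT.
have cB : prem c \notin B by apply/negP => /nq; rewrite eqxx.
have CB : ~~ (conc c \subset B) by apply/subsetPn; exists p.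
by rewrite (row_code_conc rP' (keep c cr cB CB)) // inE pB.
Qed.

(** The row is followed through the five parts of the program. [v1], [v2], [v3] describe it after
    the b's with premise in [B], the positions of [B], and [j] have become 1; [v5] describes it
    after the a's without b's have become 2. *)
Lemma denote_put_ones s j r (B := lc j) :
  focused s j r -> imposable j r -> [disjoint B & zeros r] ->
  is_row (put_ones j B r) ->
  restacks s (denote prog_put_ones s) (regs s rD) (put_ones j B r).
Proof.
case=> -[W L] J codes_r impI B0 rP'; set D := regs s rD.
rewrite /prog_put_ones 4!denote_seq.
set s1 := denote _ s; set s2 := denote (for_all_positions _) s1.
set s3 := denote _ s2; set s4 := denote (for_all_positions _) s3.
have L1 : cells s1 LCm =2 cells s LCm by move=> m n; apply: denote_cells.
have D1 : regs s1 rD = D by apply: denote_regs.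
have J1 : regs s1 rJ = j by rewrite -J; apply: denote_regs.
have W1 : regs s1 rW = w by rewrite -W; apply: denote_regs.
pose v1 n := if (3 < cells s Stk D n) && (cells s LCm j (cells s Stk D n - 4) != 0)
             then 1 else cells s Stk D n.
have fill1 m n : cells s1 Stk m n =
    if (m == D) && (n < w) then v1 n else cells s Stk m n.
  rewrite -W; apply: (denote_fill (a0 := Stk)) => // s' lt_iw R C.
  have DE : regs s' rD = D by rewrite R.
  have JE : regs s' rJ = j by rewrite R.
  have CL k : cells s' LCm j k = cells s LCm j k by rewrite C.
  have SE : cells s' Stk D (regs s' rI) = cells s Stk D (regs s' rI).
    by rewrite C // ltnn !andbF.
  rewrite /= DE JE CL SE /v1; split=> [|a k l /negPf off].
    by case: (3 < _) => //=; case: (_ == 0); rewrite /= ?eqxx ?SE.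
  by do 2!case: ifP => // _; rewrite /= off.
pose v2 n := if cells s LCm j n == 0 then v1 n else 1.
(* This sweep writes to two arrays, so it is treated with an explicit invariant. *)
have [fill2 live2] : (forall m n, cells s2 Stk m n =
    if (m == D) && (n < w) then v2 n else cells s Stk m n) /\
    (forall n, n < w -> cells s2 Live n 0 = 0).
  pose P k s' := (forall m n, cells s' Stk m n =
    if (m == D) && (n < k) then v2 n else cells s1 Stk m n) /\
    (forall n, n < k -> cells s' Live n 0 = 0).
  suff [S2 l2]: P (regs s1 rW) s2.
    rewrite W1 in S2 l2; split=> // m n; rewrite S2 fill1.
    by case: (_ && _).
  apply: denote_for => //; first by split=> // m n; rewrite andbF.
  rewrite W1 => k s' lt_kw I R C [S l].
  have DE : regs s' rD = D by rewrite R.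
  have JE : regs s' rJ = j by rewrite R.
  have CL : cells s' LCm j k = cells s LCm j k by rewrite C // L1.
  split=> [m n|n]; rewrite /= JE I CL; last first.
    case: (_ == 0); rewrite /= ltnS leq_eqVlt I; case: (n == k) => //=; exact: l.
  rewrite [n < k.+1]ltnS [n <= k]leq_eqVlt.
  have [-> | nk] := eqVneq n k; last first.
    by case: (_ == 0); rewrite /= ?DE ?I ?(negPf nk) ?andbF S.
  rewrite /v2; case: (_ == 0); rewrite /= ?DE ?I ?eqxx ?S ?ltnn ?andbF ?andbT //.
  by rewrite fill1 lt_kw; case: (m == D).
have D2 : regs s2 rD = D by rewrite -D1; apply: denote_regs.
have J2 : regs s2 rJ = j by rewrite -J1; apply: denote_regs.
have W2 : regs s2 rW = w by rewrite -W1; apply: denote_regs.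
pose v3 n := if n == j :> nat then 1 else v2 n.
have fill3 m n : cells s3 Stk m n =
    if (m == D) && (n < w) then v3 n else cells s Stk m n.
  rewrite /= D2 J2 fill2 /v3; case: (m == D) => //=.
  by case: eqP => // ->; rewrite ltn_ord.
have live4 n : n < w ->
    cells s4 Live n 0 = [exists i : 'I_w, v3 i == 4 + n].
  (* The index written in [Live] is decoded from the row entry and is not the counter; the invariant
     records which premises were met among the first [k] positions. *)
  pose P k s' := forall n, n < w ->
    cells s' Live n 0 = [exists i : 'I_w, (i < k) && (v3 i == 4 + n)].
  move=> lt_nw; rewrite -exists_ltw; move: n lt_nw.
  suff: P (regs s3 rW) s4 by rewrite [regs s3 rW]W2.
  apply: denote_for => //; first by move=> n lt_nw; rewrite exists_lt0 [LHS]live2.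
  rewrite [regs s3 rW]W2 => k s' lt_kw I R C Pk n lt_nw.
  rewrite (exists_ltnS lt_kw) /=.
  have DE : regs s' rD = D by rewrite R.
  have SE : cells s' Stk D k = v3 k by rewrite C // fill3 eqxx lt_kw.
  rewrite DE I SE; case: ltnP => /= v3k; last first.
    have -> : (v3 k == 4 + n) = false by lia.
    by rewrite orbF Pk.
  rewrite andbT; have -> : (n == v3 k - 4) = (v3 k == 4 + n) by lia.
  by case: (_ == 4 + n); rewrite ?orbT ?orbF // Pk.
have D4 : regs s4 rD = D by rewrite -D2; apply: denote_regs.
have W4 : regs s4 rW = w by rewrite -W2; apply: denote_regs.
have S4 m n : cells s4 Stk m n = cells s3 Stk m n by apply: denote_cells.
pose v5 n := if (v3 n == 3) && (cells s4 Live n 0 == 0) then 2 else v3 n.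
set s5 := denote _ s4.
have fill5 m n : cells s5 Stk m n =
    if (m == D) && (n < w) then v5 n else cells s Stk m n.
  have -> : cells s5 Stk m n =
      if (m == D) && (n < w) then v5 n else cells s4 Stk m n.
    rewrite -W4; apply: (denote_fill (a0 := Stk)) => // s' lt_iw R C.
    have DE : regs s' rD = D by rewrite R.
    have CL k : cells s' Live k 0 = cells s4 Live k 0 by rewrite C.
    have SE : cells s' Stk D (regs s' rI) = v3 (regs s' rI).
      by rewrite C ?ltnn ?andbF // S4 fill3 eqxx -W4 lt_iw.
    rewrite /= DE CL SE /v5; split=> [|a k l /negPf off].
      by case: (v3 _ == 3) => //=; case: (cells s4 Live _ _ == 0); rewrite /= ?eqxx ?SE.
    by do 2!case: ifP => // _; rewrite /= off.
  by rewrite S4 fill3; case: (_ && _).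
split=> [p|m n /negPf nD]; last by rewrite fill5 nD.
rewrite fill5 eqxx ltn_ord /v5 live4 ?ltn_ord // (row_code_put_ones impI) //.
pose f (i : 'I_w) := if [|| i == j, i \in B | [exists q in B, row_code r i == 4 + q]]
                     then 1 else row_code r i.
have v3E (i : 'I_w) : v3 i = f i.
  rewrite /v3 /v2 /v1 /f L codes_r val_eqE; case: (i == j) => //=.
  case: (i \in B) => //=; congr (if _ then _ else _).
  apply/andP/exists_inP => [[gt3]|[q qB /eqP ->]]; last by rewrite addKn L qB.
  have [c cr [Ec _]] : exists2 c, c \in imps r &
      (prem c = row_code r i - 4 :> nat) /\ i \in conc c.
    by apply: row_code_concP; [case/imposableP: impI | rewrite subnKC].
  rewrite -Ec L => pB; exists (prem c); first by case: (_ \in _) pB.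
  by rewrite Ec subnKC.
rewrite !v3E eqb0 -/(f p); congr (if _ && ~~ _ then _ else _).
by apply: eq_existsb => i; rewrite v3E.
Qed.

(** The copy at [D.+1] is completed before line [D] is changed, and the last part of the program
    rewrites no stack line other than [D]. *)
Lemma denote_split s j r (B := lc j) (s' := denote prog_split s) (D := regs s rD) :
  focused s j r -> regs s rSp = D.+1 -> imposable j r ->
  [disjoint B & zeros r] -> is_row (put_ones j B r) ->
  [/\ regs s' rSp = D.+2, codes s' D (put_ones j B r),
      codes s' D.+1 (put_zero j r), cells s' Pend D.+1 0 = j.+1
    & forall k m, k < D -> cells s' Stk k m = cells s Stk k m /\
                           cells s' Pend k m = cells s Pend k m].
Proof.
case=> -[W L] J codes_r Sp rI' B0 rP'.
rewrite /s' /prog_split 4!denote_seq.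
set s1 := denote _ s; set s2 := denote _ s1; set s3 := denote _ s2.
set s4 := denote _ s3.
have fill1 a m n : cells s1 a m n =
    if [&& arr_beq a Stk, m == D.+1 & n < w] then cells s Stk D n
    else cells s a m n.
  rewrite -W; apply: (denote_fill (v := cells s Stk D)) => // t lt_iw R C.
  have DE : regs t rD = D by rewrite R.
  have SpE : regs t rSp = D.+1 by rewrite R.
  rewrite /= DE SpE !eqxx /= C ?(ltn_eqF (leqnn _)) ?andbF //; split=> // a' k l off.
  by rewrite (negPf off).
have D1 : regs s1 rD = D by apply: denote_regs.
have J1 : regs s1 rJ = j by rewrite -J; apply: denote_regs.
have Sp1 : regs s1 rSp = D.+1 by rewrite -Sp; apply: denote_regs.
have S4 m n : cells s4 Stk m n = if (m == D.+1) && (n == j) then 0 else cells s1 Stk m n.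
  by rewrite /= Sp1 J1.
have P4 m n : cells s4 Pend m n =
    if (m == D.+1) && (n == 0) then j.+1 else cells s Pend m n.
  by rewrite /= Sp1 J1 addn1 fill1.
have Sp4 : regs s4 rSp = D.+2 by rewrite /= Sp1 addn1.
have D4 : regs s4 rD = D by rewrite -D1.
have foc4 : focused s4 j r.
  split; first split.
  - by rewrite -W /= denote_regs.
  - by move=> i i'; rewrite /= fill1 L.
  - by rewrite -J1.
  by move=> p; rewrite D4 S4 (ltn_eqF (leqnn _)) /= fill1 (ltn_eqF (leqnn _)) codes_r.
have [codesD keep] := denote_put_ones foc4 rI' B0 rP'.
rewrite D4 in codesD keep; split=> //.
- by rewrite -Sp4; apply: denote_regs.
- move=> p; rewrite keep ?S4 ?row_code_put_zero ?eqxx ?val_eqE ?(gtn_eqF (leqnn _)) //=.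
  by case: eqP => // _; rewrite fill1 eqxx ltn_ord codes_r.
- by rewrite denote_cells // P4 eqxx.
move=> k m lt_kD; have lt_kD1 : k < D.+1 by apply: ltnW.
rewrite keep ?(ltn_eqF lt_kD) // S4 (@denote_cells _ s4 Pend) // P4.
by rewrite fill1 (ltn_eqF lt_kD1).
Qed.

(** The head of the list is the top of the stack, so its index in memory is the number of rows below
    it. *)
Fixpoint stack_at (s : state) (W : seq (nat * row w)) : Prop :=
  if W is (n, r) :: W' then
    [/\ cells s Pend (size W') 0 = n, codes s (size W') r & stack_at s W']
  else True.

Lemma stack_at_frame s s' W :
  (forall k m, k < size W -> cells s' Stk k m = cells s Stk k m /\
                             cells s' Pend k m = cells s Pend k m) ->
  stack_at s W -> stack_at s' W.
Proof.
elim: W => [|[n r] W IHW] //= same [Pn Cr sW]; split.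
- by have [_ ->] := same _ 0 (leqnn _).
- by move=> p; have [-> _] := same _ p (leqnn _).
by apply: IHW => // k m /ltnW; apply: same.
Qed.

Lemma denote_if e c1 c2 s :
  denote (If e c1 c2) s = if eval s e == 0 then denote c2 s else denote c1 s.
Proof. by []. Qed.

(** The flags express inclusions of [lc j] in unions of parts of [r]. The program tests them in
    another order than [impose], but once [lc j] meets no zeros, the absence of a's and b's means
    containment in ones and twos, and then the absence of 2's means containment in the ones. *)
Lemma denote_impose s (j : 'I_w) (r : row w) W (s' := denote prog_impose s)
    (W' := [seq (j.+1, r') | r' <- impose j (lc j) r] ++ W) :
  focused s j r -> imposable j r -> regs s rD = size W ->
  regs s rSp = (size W).+1 -> stack_at s W ->
  regs s' rSp = size W' /\ stack_at s' W'.
Proof.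
move=> foc impI Dw Spw sW.
have [Z T A] := denote_scan foc.
rewrite /s' /prog_impose 2!denote_seq.
set s1 := denote prog_scan s in Z T A *; set s2 := denote _ s1.
have C1 a m n : cells s1 a m n = cells s a m n by apply: denote_cells.
have J1 : regs s1 rJ = j by case: foc => _ <- _; apply: denote_regs.
have D1 : regs s1 rD = size W by rewrite -Dw; apply: denote_regs.
have Sp1 : regs s1 rSp = (size W).+1 by rewrite -Spw; apply: denote_regs.
have foc1 : focused s1 j r.
  case: foc => inp _ codes_r; split=> //; first exact: input_state_denote.
  by move=> p; rewrite D1 C1 -Dw.
have D2 : regs s2 rD = size W by rewrite -D1; apply: denote_regs.
have J2 : regs s2 rJ = j by rewrite -J1; apply: denote_regs.
have sW1 : stack_at s1 W by apply: stack_at_frame sW => k m _; rewrite !C1.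
(* Common conclusion of the three cases that return a single row. *)
have one r' : regs s2 rSp = regs s1 rSp ->
    (forall m n, cells s2 Pend m n = cells s1 Pend m n) ->
    restacks s1 s2 (regs s1 rD) r' ->
    regs s2 rSp = (size W).+1 /\
    stack_at (denote (Store Pend rD 0 (Add rJ 1)) s2) ((j.+1, r') :: W).
  rewrite D1 => -> P2 [codes2 keep]; split=> //; split=> /=.
  - by rewrite D2 J2 addn1 eqxx.
  - exact: codes2.
  apply: stack_at_frame sW1 => k m lt_kW /=.
  by rewrite D2 (ltn_eqF lt_kW) /= keep ?(ltn_eqF lt_kW).
have rP : is_row r by case/imposableP: impI.
have flagE (q : pred nat) (X : {set 'I_w}) :
    (forall p, q (row_code r p) = (p \notin X)) ->
    [exists p, (p \in lc j) && q (row_code r p)] = ~~ (lc j \subset X).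
  move=> qE; apply/existsP/subsetPn => [[p /andP[pB]]|[p pB pA]].
    by rewrite qE; exists p.
  by exists p; rewrite pB qE.
have {}Z : regs s1 rZero = ~~ [disjoint lc j & zeros r].
  rewrite Z disjoints_subset; congr nat_of_bool; apply: (flagE (fun v => v == 0)) => p.
  by rewrite in_setC negbK; case: (row_positionP p rP).
have {}T : regs s1 rTwo = ~~ (lc j \subset ~: twos r).
  rewrite T; congr nat_of_bool; apply: (flagE (fun v => v == 2)) => p.
  by rewrite in_setC negbK; case: (row_positionP p rP).
have {}A : regs s1 rAB = ~~ (lc j \subset zeros r :|: ones r :|: twos r).
  rewrite A; congr nat_of_bool; apply: (flagE (fun v => 2 < v)) => p.
  by rewrite !inE; case: (row_positionP p rP).
have s2E : s2 =
    if [disjoint lc j & zeros r] then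
      if lc j \subset zeros r :|: ones r :|: twos r then
        if lc j \subset ~: twos r then s1 else denote prog_put_ab s1
      else denote prog_split s1
    else denote prog_put_zero s1.
  rewrite /s2 3!denote_if [eval _ rZero]Z [eval _ rAB]A [eval _ rTwo]T.
  by rewrite !eqb0 !negbK.
have := imposable_impose (@lc_lt j) impI.
rewrite /W' /impose {W' s'}; clearbody s2.
have [B0|B0] := boolP [disjoint lc j & zeros r]; last first.
  rewrite (negPf B0) in s2E; move=> _; apply: one; rewrite s2E //.
  exact: denote_put_zero foc1.
have sub12 : (lc j \subset zeros r :|: ones r :|: twos r) =
             (lc j \subset ones r :|: twos r).
  apply/subsetP/subsetP => sub p pB; have := sub p pB; rewrite !inE.
    by rewrite (disjointFr B0 pB).
  by case/orP=> ->; rewrite ?orbT.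
rewrite B0 sub12 in s2E.
have [B12|B12] := boolP (lc j \subset ones r :|: twos r).
  have sub1 : (lc j \subset ~: twos r) = (lc j \subset ones r).
    apply/subsetP/subsetP => sub p pB; have := sub p pB; rewrite inE.
      by have := subsetP B12 p pB; rewrite inE => /orP[-> //|->].
    by case: (row_positionP p rP).
  rewrite B12 sub1 in s2E.
  have [B1|B1] := boolP (lc j \subset ones r).
    rewrite B1 in s2E; move=> _; apply: one; rewrite s2E //.
    by split=> // p; case: foc1 => _ _ ->.
  rewrite (negPf B1) in s2E; rewrite all_seq1 => /imposableP[rP' _].
  apply: one; rewrite s2E.
  - exact: denote_regs.
  - by move=> m n; apply: denote_cells.
  exact: denote_put_ab foc1 impI rP' B12.
rewrite (negPf B12) in s2E.
have [B1|_] := boolP (lc j \subset ones r).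
  by rewrite (subset_trans B1) ?subsetUl in B12.
case/and3P=> _ /imposableP[rP' _] _.
have [|Sp' codesD codesD1 PD keep] := denote_split foc1 _ impI B0 rP'.
  by rewrite Sp1 D1.
rewrite D1 -s2E in Sp' codesD codesD1 PD keep.
split=> //=; rewrite D2 J2 addn1; split.
- by rewrite (gtn_eqF (leqnn _)).
- exact: codesD1.
split; [by rewrite eqxx | exact: codesD |].
apply: stack_at_frame sW1 => k m lt_kW; rewrite /= (ltn_eqF lt_kW).
exact: keep.
Qed.

(** * The main loop and its running time *)

Definition represents (s : state) (C : config w) : Prop :=
  [/\ input_state lc s, regs s rSp = size C.1, stack_at s C.1 & output_state C.2 s].

Definition loop_body : cmd :=
  (rD <~ Defs.Sub rSp 1 ;; rJ <~ Pend![rD, 0] ;;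
   If (Eqn rJ rW) prog_finish prog_impose)%prog.

Lemma denote_loop_body s n r W F :
  represents s ((n, r) :: W, F) -> n <= w -> imposable n r ->
  represents (denote loop_body s) (ab_step lc ((n, r) :: W, F)).
Proof.
case=> inp Sp [Pn codes_r sW] out le_nw rI; rewrite [size _]/= in Sp out.
rewrite /loop_body 2!denote_seq denote_if; set s1 := denote (Assign rJ _) _.
have W1 : regs s1 rW = w by case: inp.
have D1 : regs s1 rD = size W by rewrite /= Sp subn1.
have J1 : regs s1 rJ = n by rewrite /= Sp subn1.
have inp1 : input_state lc s1 by case: inp.
have sW1 : stack_at s1 W by apply: stack_at_frame sW.
have -> : eval s1 (Eqn rJ rW) = (regs s1 rJ == regs s1 rW) by [].
rewrite J1 W1 eqb0 if_neg; case: eqP => [nw|/eqP nw]; last first.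
  have lt_nw : n < w by rewrite ltn_neqAle nw.
  pose j := Ordinal lt_nw.
  have foc : focused s1 j r by split=> // p; rewrite D1; apply: codes_r.
  have [|Sp' sW'] := denote_impose foc rI D1 _ sW1; first exact: Sp.
  rewrite /ab_step insubT; split.
  - exact: input_state_denote.
  - exact: Sp'.
  - exact: sW'.
  case: out => NF out; split=> [|k r0 p ltk]; first by rewrite denote_regs.
  by rewrite denote_cells //; apply: out.
rewrite /ab_step nw insubF ?ltnn //; case: out => NF out.
rewrite /prog_finish 2!denote_seq; set s2 := denote _ s1.
have fill a m k : cells s2 a m k =
    if [&& arr_beq a Fin, m == size F & k < w] then cells s1 Stk (size W) k
    else cells s1 a m k.
  rewrite -[in k < _]W1; apply: (denote_fill (v := cells s1 Stk (size W))) => // t lt_iw R C.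
  have DE : regs t rD = size W by rewrite R.
  have NE : regs t rNf = size F by rewrite R // -NF.
  rewrite /= DE NE !eqxx /= C //; split=> // a' m' k' off.
  by rewrite (negPf off).
have D2 : regs s2 rD = size W by rewrite -D1; apply: denote_regs.
have N2 : regs s2 rNf = size F by rewrite -NF; apply: denote_regs.
split=> /=.
- have [W2 L2] : input_state lc s2 by apply: input_state_denote.
  by split=> // i i'; apply: L2.
- by rewrite D2.
- by apply: stack_at_frame sW => k m _; rewrite /= !fill.
split=> [|k r0 p]; first by rewrite /= N2 size_rcons addn1.
rewrite size_rcons ltnS leq_eqVlt nth_rcons /= fill ltn_ord andbT.
case: eqP => [-> _|_ /= ltk]; first by rewrite ltnn; apply: codes_r.
by rewrite ltk; apply: out.
Qed.

(** Without nested sweeps the bound is affine in [w], with both coefficients at most 300. *)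
Lemma time_loop_body : time_bound w loop_body <= 300 * w.+1.
Proof. by rewrite /=; lia. Qed.

Lemma sweeping_loop_body : sweeping loop_body.
Proof. by repeat constructor. Qed.

Definition pending_ok (W : seq (nat * row w)) : bool :=
  all (fun x => (x.1 <= w) && imposable x.1 x.2) W.

Lemma pending_ok_step n r W F :
  pending_ok ((n, r) :: W) -> pending_ok (ab_step lc ((n, r) :: W, F)).1.
Proof.
move=> /andP[/andP[/= le_nw rI] WP]; rewrite /ab_step.
case: insubP => [j lt_nw jn|_] //=; rewrite -jn in rI *.
rewrite /pending_ok all_cat all_map; apply/andP; split=> //.
apply: sub_all (imposable_impose (@lc_lt j) rI) => r' r'I.
by rewrite /= r'I ltn_ord.
Qed.

Lemma exec_main_loop m W F G s :
  represents s (W, F) -> pending_ok W ->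
  iter m (ab_step lc) (W, F) = ([::], G) ->
  exists t s',
    [/\ exec s (While (Ltn 0 rSp) loop_body) t s', output_state G s'
      & t <= m * (300 * w.+1 + 4) + 4].
Proof.
elim: m W F s => [|m IHm] [|[n r] W] F s rep WP //.
- case=> <-; exists 4, s; case: rep => _ Sp _ out; split=> //.
  by apply: (ExecWhileFalse (e := Ltn 0 rSp)); rewrite /= Sp.
(* A configuration with empty working stack is stationary, while the program stops at once. *)
- have -> : iter m.+1 (ab_step lc) ([::], F) = ([::], F).
    by elim: (m.+1) => //= k ->.
  case=> <-; exists 4, s; case: rep => _ Sp _ out; split=> //; last by rewrite leq_addl.
  by apply: (ExecWhileFalse (e := Ltn 0 rSp)); rewrite /= Sp.
have /andP[/andP[le_nw rI] _] := WP.
have := denote_loop_body rep le_nw rI; have := pending_ok_step F WP.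
rewrite iterSr; case: (ab_step _ _) => W' F' WP' rep' run.
have [t1 ex1 le1] := exec_sweeping s sweeping_loop_body.
have [t2 [s' [ex2 out le2]]] := IHm _ _ _ rep' WP' run.
exists (3 + t1 + t2).+1, s'; split=> //.
  by apply: (ExecWhileTrue (e := Ltn 0 rSp)) ex1 ex2; case: rep => _ /= -> _ _.
have [[W0 _] _ _ _] := rep; rewrite W0 in le1.
have := leq_trans le1 time_loop_body; rewrite mulSn; lia.
Qed.

Lemma represents_init s :
  input_state lc s -> represents (denote prog_init s) (init_config w).
Proof.
move=> inp; have [W0 _] := inp.
rewrite /prog_init 3!denote_seq; set s1 := denote _ s.
have fill a m k : cells s1 a m k =
    if [&& arr_beq a Stk, m == 0 & k < w] then 2 else cells s a m k.
  rewrite -[in k < _]W0; apply: (denote_fill (v := fun=> 2)) => // t _ _ _.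
  rewrite /= !eqxx; split=> // a' m' k' off.
  by rewrite (negPf off).
have [W1 L1] : input_state lc s1 by apply: input_state_denote.
split=> //.
split=> // p; rewrite /= fill /= ltn_ord.
by rewrite /row_code !inE.
Qed.

Lemma exec_ab_program m G s :
  input_state lc s ->
  iter m (ab_step lc) (init_config w) = ([::], G) ->
  exists t s',
    [/\ exec s ab_program t s', output_state G s'
      & t <= m * (300 * w.+1 + 4) + 30 * w.+1].
Proof.
move=> inp run.
have sw : sweeping prog_init by repeat constructor.
have [t1 ex1 le1] := exec_sweeping s sw.
have init_ok : pending_ok (init_config w).1.
  rewrite /= andbT; apply/imposableP; split=> [|i _]; last by rewrite inE.
  by apply/is_rowP; split=> // p; rewrite /multiplicity !inE.
have [t2 [s' [ex2 out le2]]] := exec_main_loop (represents_init inp) init_ok run.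
exists (t1 + t2), s'; split=> //; first exact: ExecSeq ex1 ex2.
(* The summand [30 * w.+1] covers the initialisation and the final failing test. *)
have [W0 _] := inp; rewrite W0 /= in le1; lia.
Qed.

End Machine.

Theorem theorem5 :
  exists K : nat,
  forall (d : Order.disp_t) (T : finPOrderType d) (w : nat) (lab : 'I_w -> T),
    linear_extension lab ->
    exists F : seq (row w),
      [/\ ab_final_rows (LC lab) F,
          all (@is_row w) F,
          \bigcup_(r <- F) row_family r
            = [set X : {set 'I_w} | order_ideal (lab @: X)],
          pairwise
            (fun r1 r2 : row w => [disjoint row_family r1 & row_family r2]) F
        & forall s : state, input_state (LC lab) s ->
            exists (t : nat) (s' : state),
              [/\ exec s ab_program t s',
                  output_state F s'
                & 0 < w -> t <= K * (size F * w ^ 2)]].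
Proof.
(* For positive [w] there are at most [size F * (2 * w)] steps of at most [604 * w] units, which
   gives 1208; the remaining [30 * w.+1] is at most [60 * w], hence at most 60 times
   [size F * w ^ 2] because [F] is nonempty. *)
exists 1300 => d T w lab lab_ext.
have [m [F [run [F0 le_m] rows fam disj]]] := ab_algorithm_correct lab_ext.
exists F; split=> //; first by exists m.
move=> s inp.
have [t [s' [ex out le_t]]] := exec_ab_program (LC_lt lab_ext) inp run.
exists t, s'; split=> // w0; apply: leq_trans le_t _.
have le1 : w.+1 <= 2 * w by lia.
have le_w : w <= size F * w ^ 2.
  by rewrite -mulnn mulnA -[X in X <= _]mul1n leq_mul2r muln_gt0 F0 w0 orbT.
have : m * (300 * w.+1 + 4) <= 1208 * (size F * w ^ 2).
  have le2 : 300 * w.+1 + 4 <= 604 * w by lia.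
  have le3 : m <= size F * (2 * w) by apply: leq_trans le_m _; rewrite leq_mul2l le1 orbT.
  apply: leq_trans (leq_mul le3 le2) _.
  by rewrite -mulnn; lia.
lia.
Qed.
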